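(* Let $N\ge 1$, $\gamma_{th}>0$, and let $\bar\gamma_{uv}>0$ and $\bar\gamma_{1v},\dots,\bar\gamma_{Nv}>0$ be the mean SNRs at a ground user equipment (UE) $v$ of the link from its serving base station $u$ and of the links from its interfering base stations $t=1,\dots,N$. Let the instantaneous SNRs $\gamma_{uv},\gamma_{1v},\dots,\gamma_{Nv}$ be independent exponentially distributed random variables (Rayleigh fading) with means $\bar\gamma_{uv},\bar\gamma_{1v},\dots,\bar\gamma_{Nv}$ respectively, and let $$SINR_{uv}=\frac{\gamma_{uv}}{1+\sum_{t=1}^N\gamma_{tv}}.$$ Let $\alpha_1,\dots,\alpha_N$ be the unique real numbers satisfying the partial fraction decomposition (identity of rational functions in $x$) $$\prod_{t=1}^{N}(1-x\bar\gamma_{tv})^{-1}=\sum_{t=1}^{N}\frac{\alpha_t}{x-\frac{1}{\bar\gamma_{tv}}}.$$ Then the outage probability $P^{UE}_{out,uv}(\gamma_{th})=\mathbb{P}(SINR_{uv}\le\gamma_{th})$ is $$P^{UE}_{out,uv}(\gamma_{th})=1+\exp\left(-\frac{\gamma_{th}}{\bar\gamma_{uv}}\right)\sum_{t=1}^{N}\frac{\alpha_t}{\frac{\gamma_{th}}{\bar\gamma_{uv}}+\frac{1}{\bar\gamma_{tv}}}.$$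
   Context: Downlink cellular model: a base station $u$ transmits to a UE $v$; the base stations $t=1,\dots,N$ transmit on the same sub-carrier and interfere. The instantaneous SNR of a link from base station $w$ to $v$ is $\gamma_{wv}=P_w|\alpha_{wv}|^2/N_0$, with $P_w>0$ the transmit power, $\alpha_{wv}$ the fading channel gain and $N_0>0$ the noise variance. Its mean is $\bar\gamma_{wv}=P_w\,10^{-PL_{wv}/10}/N_0$, where $PL_{wv}=15.3+37.6\log_{10}d_{wv}$ and $d_{wv}>0$ is the distance in meters. Rayleigh fading means that $\gamma_{wv}$ is exponentially distributed with mean $\bar\gamma_{wv}$. Existence of the numbers $\alpha_t$ satisfying the decomposition is part of the hypotheses. *)

(* Defs.v *)
From HB Require Import structures.
From mathcomp Require Import all_boot all_order all_algebra.
From mathcomp Require Import all_classical all_reals all_analysis.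

Set Implicit Arguments.
Unset Strict Implicit.
Unset Printing Implicit Defensive.

Import Order.TTheory GRing.Theory Num.Theory.
Import numFieldNormedType.Exports.

Local Open Scope classical_set_scope.
Local Open Scope ring_scope.

(* The product rule is required over every subfamily J, with arbitrary
   measurable sets. *)
Definition mutually_independent (d : measure_display) (T : measurableType d)
    (R : realType) (P : probability T R) (I : finType)
    (X : I -> {RV P >-> R}) : Prop :=
  forall (J : {set I}) (A : I -> set R), (forall i, measurable (A i)) ->
    P (\bigcap_(i in [set` J]) (X i @^-1` A i)) =
    (\prod_(i in J) P (X i @^-1` A i))%E.

(* The library's exponential law is indexed by its rate; here it is indexed by
   its mean m. The laws are compared on Borel sets only. *)
Definition exponential_of_mean (d : measure_display) (T : measurableType d)
    (R : realType) (P : probability T R) (X : {RV P >-> R}) (m : R) : Prop :=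
  (exists2 r : R, 0 < r & forall A : set R, measurable A ->
     distribution P X A = exponential_prob r A) /\
  'E_P[X]%E = m%:E.

(* Joint family of all links: None is the serving link, Some t is the
   t-th interfering link. *)
Definition all_links (N : nat) (U : Type) (serving : U)
    (interf : 'I_N -> U) (i : option 'I_N) : U :=
  if i is Some t then interf t else serving.

Definition SINR (T : Type) (R : realType) (N : nat) (serving : T -> R)
    (interf : 'I_N -> T -> R) (w : T) : R :=
  serving w / (1 + \sum_(t < N) interf t w).

Definition outage_probability (d : measure_display) (T : measurableType d)
    (R : realType) (P : probability T R) (sinr : T -> R) (gth : R) : \bar R :=
  P [set w | sinr w <= gth].

(* An identity in the field R(x) of rational functions. *)
Definition partial_fraction_decomposition (R : realType) (N : nat)
    (m alpha : 'I_N -> R) : Prop :=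
  \prod_(t < N) (tofrac (1 - 'X * (m t)%:P))^-1 =
  \sum_(t < N) tofrac (alpha t)%:P / tofrac ('X - (1 / m t)%:P)
  :> {fraction {poly R}}.

(* Main.v *)
Require Import Defs.
From HB Require Import structures.
From mathcomp Require Import all_boot all_order all_algebra.
From mathcomp Require Import all_classical all_reals all_analysis.
From mathcomp Require Import measurable_realfun.

Set Implicit Arguments.
Unset Strict Implicit.
Unset Printing Implicit Defensive.

Import Order.TTheory GRing.Theory Num.Theory.
Import numFieldNormedType.Exports.

Local Open Scope classical_set_scope.
Local Open Scope ring_scope.

(* Conditionally on the total interference S, the serving link exceeds
   gth * (1 + S) with probability exp (- c * (1 + S)), where c = gth / mean_u,
   as soon as S >= 0 (which holds almost surely).  Averaging over S leaves
   exp (- c) times the Laplace transform of S at c, which by independence is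
   the product of the factors (1 + c * mean t)^-1.  This is the left-hand side
   of the partial fraction identity at x = - c, a point that is not a pole
   because c > 0.  The product rule for events only gives the independence of
   the partial sums of S from the other links through a pi-lambda argument,
   adding one link at a time. *)

(** * Integration against a measure given by a density *)

Section density.
Local Open Scope ereal_scope.
Context (d : measure_display) (T : measurableType d) (R : realType)
  (mu nu : {measure set T -> \bar R}) (g : T -> R).
Hypotheses (mg : measurable_fun setT g) (g0 : forall x, (0 <= g x)%R).
Hypothesis nuE : forall A, measurable A -> nu A = \int[mu]_(x in A) (g x)%:E.

Let mEg : measurable_fun setT (EFin \o g).
Proof. exact/measurable_EFinP. Qed.

Import HBNNSimple.

Let ge0_integral_density_nnsfun (h : {nnsfun T >-> R}) :
  \int[nu]_x (h x)%:E = \int[mu]_x ((h x)%:E * (g x)%:E).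
Proof.
have mh y : measurable (h @^-1` [set y]) by [].
under [LHS]eq_integral do rewrite fimfunE -fsumEFin//.
rewrite [LHS]ge0_integral_fsum//; last 2 first.
  - by move=> r; exact/measurable_EFinP/measurableT_comp.
  - by move=> n x _; rewrite EFinM nnfun_muleindic_ge0.
under [RHS]eq_integral.
  move=> x _; rewrite fimfunE -fsumEFin// ge0_mule_fsuml; last first.
    by move=> r; rewrite EFinM nnfun_muleindic_ge0.
  over.
rewrite [RHS]ge0_integral_fsum//; last 2 first.
  - move=> r; apply: emeasurable_funM => //.
    by apply/measurable_EFinP; do 2 apply/measurableT_comp => //.
  - move=> n x _; rewrite mule_ge0 ?lee_fin// -lee_fin EFinM.
    exact: nnfun_muleindic_ge0.
apply: eq_fsbigr => y; rewrite inE => -[x _ hxy].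
have y0 : (0 <= y)%R by rewrite -hxy.
under eq_integral do rewrite EFinM.
rewrite ge0_integralZl//; [|exact/measurable_EFinP].
rewrite integral_indic// setIT nuE//.
under [RHS]eq_integral do rewrite EFinM -muleA.
rewrite ge0_integralZl//; last 2 first.
- by apply: emeasurable_funM => //; exact/measurable_EFinP.
- by move=> z _; rewrite mule_ge0// lee_fin.
congr (_ * _); rewrite integral_mkcond; apply: eq_integral => z _.
by rewrite patchE indicE; case: ifP => _; rewrite ?mul1e ?mul0e.
Qed.

(** Simple functions reduce by linearity to indicators, where [nuE] applies. Monotone convergence on
    both sides then reaches [f]; since [g] is nonnegative, multiplying the approximations by [g]
    keeps them nondecreasing. *)
Lemma ge0_integral_density (f : T -> \bar R) :
  measurable_fun setT f -> (forall x, 0 <= f x) ->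
  \int[nu]_x f x = \int[mu]_x (f x * (g x)%:E).
Proof.
move=> mf f0; pose f_ := nnsfun_approx measurableT mf.
have f_cvg x : (f_ n x)%:E @[n --> \oo] --> f x by exact: cvg_nnsfun_approx.
have f_nd x : {homo (fun n => (f_ n x)%:E) : m n / (m <= n)%N >-> m <= n}.
  by move=> m n mn; rewrite lee_fin; exact/lefP/nd_nnsfun_approx.
transitivity (limn (fun n => \int[nu]_x (f_ n x)%:E)).
  rewrite -monotone_convergence//.
  - by apply: eq_integral => x _; exact/esym/cvg_lim.
  - by move=> n; exact/measurable_EFinP.
  - by move=> n x _; rewrite lee_fin.
transitivity (limn (fun n => \int[mu]_x ((f_ n x)%:E * (g x)%:E))).
  by congr (limn _); apply/funext => n; exact: ge0_integral_density_nnsfun.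
rewrite -monotone_convergence//.
- apply: eq_integral => x _; apply/cvg_lim => //.
  by apply: cvgeZr => //; exact: f_cvg.
- by move=> n; apply: emeasurable_funM => //; exact/measurable_EFinP.
- by move=> n x _; rewrite mule_ge0// lee_fin.
- by move=> x _ m n mn; rewrite lee_wpmul2r ?lee_fin// -lee_fin f_nd.
Qed.

End density.

(** Lets an event be replaced by one that agrees with it wherever the exponential variables are
    nonnegative, which they are only almost surely. *)
Lemma ae_eq_prob (d : measure_display) (T : measurableType d) (R : realType)
    (P : probability T R) (A B : set T) :
  measurable A -> measurable B -> {ae P, forall w, A w <-> B w} -> P A = P B.
Proof.
move=> mA mB AB.
rewrite -[A]setIT -[B]setIT -!integral_indic//.
apply: ae_eq_integral => //.
- exact/measurable_EFinP.
- exact/measurable_EFinP.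
apply: filterS AB => w AB _; rewrite !indicE; congr ((nat_of_bool _)%:R%:E).
by apply/idP/idP; rewrite !inE => /AB.
Qed.

(** * Independence: from events to sums, joint laws and integrals *)

Section independence.
Local Open Scope ereal_scope.
Context (d : measure_display) (T : measurableType d) (R : realType)
  (P : probability T R).

(** Rectangles are stable under intersection and generate the product sigma-algebra. With finite
    total mass, the constant sequence [setT] serves as the exhaustion. *)
Lemma eq_measure_rectangles d1 d2 (T1 : measurableType d1)
    (T2 : measurableType d2) (m1 m2 : {measure set (T1 * T2) -> \bar R}) :
  m1 setT < +oo ->
  (forall A B, measurable A -> measurable B -> m1 (A `*` B) = m2 (A `*` B)) ->
  forall C, measurable C -> m1 C = m2 C.
Proof.
move=> m1fin m12 C mC.
apply: (measure_unique [set A `*` B | A in measurable & B in measurable]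
                       (fun=> setT)) => //.
- exact: measurable_prod_measurableType.
- move=> _ _ [A1 mA1 [B1 mB1 <-]] [A2 mA2 [B2 mB2 <-]].
  exists (A1 `&` A2); first exact: measurableI.
  by exists (B1 `&` B2); [exact: measurableI|rewrite setXI].
- by move=> _; exists setT => //; exists setT => //; rewrite setXTT.
- by rewrite bigcup_const//; exists 0%N.
- by move=> _ [A mA [B mB <-]]; exact: m12.
Qed.

Definition pair_RV (X Y : {RV P >-> R}) : {RV P >-> (R * R)%type} :=
  mfun_Sub (mem_set (measurable_fun_pair (measurable_funPT X)
                                         (measurable_funPT Y))).

Definition sum_RV (I : Type) (s : seq I) (X : I -> {RV P >-> R}) :
  {RV P >-> R} :=
  mfun_Sub (mem_set (measurable_sum s (fun i => measurable_funPT (X i)))).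

(** As functions of [C], both sides are finite measures on the plane: the image of [P] restricted to
    [E], and the joint law scaled by [P E]. Hence rectangles suffice. *)
Lemma pair_indep_event (X Y : {RV P >-> R}) (E : set T) :
  measurable E ->
  (forall A B, measurable A -> measurable B ->
    P (X @^-1` A `&` Y @^-1` B `&` E) = P (X @^-1` A `&` Y @^-1` B) * P E) ->
  forall C, measurable C ->
    P (pair_RV X Y @^-1` C `&` E) = P (pair_RV X Y @^-1` C) * P E.
Proof.
move=> mE XYE C mC.
have PE : P E = (fine (P E))%:E by rewrite fineK// fin_num_measure.
have e0 : (0 <= fine (P E))%R by rewrite fine_ge0.
pose m1 : {measure set (R * R) -> \bar R} :=
  pushforward (mrestr P mE) (pair_RV X Y).
pose m2 : {measure set (R * R) -> \bar R} :=
  mscale (NngNum e0) (distribution P (pair_RV X Y)).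
suff m12 : m1 (measurable_funPT _) C = m2 C by rewrite PE muleC; exact: m12.
apply: eq_measure_rectangles => //.
  change (P (pair_RV X Y @^-1` setT `&` E) < +oo).
  by rewrite preimage_setT setTI (le_lt_trans (probability_le1 P mE))// ltry.
move=> A B mA mB.
change (P (pair_RV X Y @^-1` (A `*` B) `&` E) =
        (fine (P E))%:E * P (pair_RV X Y @^-1` (A `*` B))).
by rewrite muleC -PE; exact: XYE.
Qed.

Lemma sum_RV_cons (I : Type) i (s : seq I) (X : I -> {RV P >-> R}) :
  sum_RV (i :: s) X = (fun w => X i w + sum_RV s X w)%R :> (T -> R).
Proof. by apply/funext => w /=; rewrite big_cons. Qed.

Lemma bigcap_mem_set1 (I : finType) (U : Type) (j : I) (F : I -> set U) :
  \bigcap_(i in [set` [set j]%SET]) F i = F j.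
Proof.
apply/seteqP; split=> w /=; first by move=> /(_ j); rewrite /= inE eqxx; apply.
by move=> Fj i /=; rewrite inE => /eqP ->.
Qed.

(** The extra event over an arbitrary [K] disjoint from [s] makes the induction go through: when [j]
    is added to the sum, the induction hypothesis is applied with [j |: K]. *)
Lemma mutually_indep_sum_event (I : finType) (X : I -> {RV P >-> R})
    (s : seq I) (K : {set I}) (A : I -> set R) (C : set R) :
  mutually_independent X ->
  uniq s -> (forall i, i \in s -> i \notin K) ->
  (forall i, measurable (A i)) -> measurable C ->
  P (sum_RV s X @^-1` C `&` \bigcap_(i in [set` K]) (X i @^-1` A i)) =
  P (sum_RV s X @^-1` C) * P (\bigcap_(i in [set` K]) (X i @^-1` A i)).
Proof.
move=> indX; elim: s K A C => [|j s IHs] K A C /=.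
  move=> _ _ mA mC.
  (* The empty sum is the constant 0, so its preimage of [C] is everything or nothing. *)
  have [C0|C0] := pselect (C 0%R).
    have -> : sum_RV [::] X @^-1` C = setT.
      by rewrite -subTset => w _ /=; rewrite big_nil.
    by rewrite setTI probability_setT mul1e.
  have -> : sum_RV [::] X @^-1` C = set0.
    by rewrite -subset0 => w /=; rewrite big_nil.
  by rewrite set0I measure0 mul0e.
move=> /andP[js us] sK mA mC.
have jK : j \notin K by apply: sK; rewrite mem_head.
(* Overriding [A] at [j] turns an event on [X j] together with the event over [K] into a single
   event over [j |: K]; as [j] is not in [K], nothing else changes. *)
have bigJ (B : set R) : \bigcap_(i in [set` j |: K])
      (X i @^-1` (fun i => if i == j then B else A i) i) =
    X j @^-1` B `&` \bigcap_(i in [set` K]) (X i @^-1` A i).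
  apply/seteqP; split=> w /=.
    move=> h; split; first by have := h j; rewrite /= eqxx setU11; apply.
    move=> i iK; have := h i; rewrite /= in_setU1 iK orbT.
    by case: eqP => [ij|_]; [move: jK; rewrite -ij iK|apply].
  move=> [Bj h] i /=; rewrite in_setU1; case: eqP => [-> //|_ /= iK].
  exact: h.
have mJ (B : set R) : measurable B ->
    forall i, measurable ((fun i => if i == j then B else A i) i).
  by move=> mB i; case: ifP.
have sjK i : i \in s -> i \notin j |: K.
  move=> is_; rewrite in_setU1 negb_or sK ?inE ?is_ ?orbT// andbT.
  by apply: contraNneq js => <-.
have mE : measurable (\bigcap_(i in [set` K]) (X i @^-1` A i)).
  apply: fin_bigcap_measurable => // i _.
  exact: measurable_funPTI.
set E := \bigcap_(i in [set` K]) (X i @^-1` A i) in bigJ mE *.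
have XjE B : measurable B -> P (X j @^-1` B `&` E) = P (X j @^-1` B) * P E.
  move=> mB; rewrite -bigJ indX; last exact: mJ.
  rewrite big_setU1//= eqxx; congr (_ * _).
  rewrite /E indX//; apply: eq_bigr => i iK.
  by case: eqP => // ij; move: jK; rewrite -ij iK.
have SXj B D : measurable B -> measurable D ->
    P (sum_RV s X @^-1` D `&` X j @^-1` B) =
    P (sum_RV s X @^-1` D) * P (X j @^-1` B).
  move=> mB mD; have := IHs [set j]%SET (fun=> B) D us _ (fun=> mB) mD.
  rewrite bigcap_mem_set1.
  by apply => i is_; rewrite inE; apply: contraNneq js => <-.
(* Pulling [C] back along addition makes the event on the longer sum an event on the pair, so that
   only rectangles remain to be checked. *)
pose C' : set (R * R) := (fun p => p.1 + p.2)%R @^-1` C.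
have mC' : measurable C'.
  rewrite -[X in measurable X]setTI.
  by apply: measurable_funD.
have -> : sum_RV (j :: s) X @^-1` C = pair_RV (X j) (sum_RV s X) @^-1` C'.
  by rewrite sum_RV_cons.
apply: pair_indep_event => // B D mB mD.
rewrite [X in X `&` E]setIC -setIA -bigJ IHs//; last exact: mJ.
by rewrite bigJ XjE// muleA -SXj// setIC.
Qed.

Definition indep_RV (X Y : {RV P >-> R}) : Prop :=
  forall A B, measurable A -> measurable B ->
  P (X @^-1` A `&` Y @^-1` B) = P (X @^-1` A) * P (Y @^-1` B).

Lemma mutually_indep_sum (I : finType) (X : I -> {RV P >-> R}) j (s : seq I) :
  mutually_independent X -> uniq (j :: s) -> indep_RV (sum_RV s X) (X j).
Proof.
move=> indX /= /andP[js us] A B mA mB.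
have := @mutually_indep_sum_event _ X s [set j]%SET (fun=> B) A indX us.
rewrite bigcap_mem_set1; apply => // i is_.
by rewrite inE; apply: contraNneq js => <-.
Qed.

Lemma indep_RV_joint_law (X Y : {RV P >-> R}) : indep_RV X Y ->
  forall C, measurable C ->
  distribution P (pair_RV X Y) C = (distribution P X \x distribution P Y) C.
Proof.
move=> XY C mC; apply/esym.
apply: (product_measure_unique (m1 := distribution P X)
  (m2 := distribution P Y) (m' := distribution P (pair_RV X Y))) => //.
Qed.

(** The joint law is the product of the marginals, so Tonelli applies; each marginal integral is
    then pulled back to [P]. *)
Lemma ge0_integral_indep (X Y : {RV P >-> R}) (f : R * R -> \bar R) :
  indep_RV X Y -> measurable_fun setT f -> (forall p, 0 <= f p) ->
  \int[P]_w f (X w, Y w) = \int[P]_w \int[P]_w' f (X w, Y w').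
Proof.
move=> XY mf f0.
rewrite -(ge0_integral_distribution (pair_RV X Y) mf f0).
rewrite (eq_measure_integral (distribution P X \x distribution P Y)); last first.
  by move=> C mC _; exact: indep_RV_joint_law.
rewrite fubini_tonelli1// ge0_integral_distribution//; last 2 first.
- exact: measurable_fun_fubini_tonelli_F.
- by move=> x; apply: integral_ge0.
apply: eq_integral => w _ /=.
rewrite /fubini_F ge0_integral_distribution//.
exact: measurableT_comp.
Qed.

(** Multiplicativity of the Laplace transform: the exponential splits over the head and the tail of
    the list, and the tail sum is independent of the head. *)
Lemma integral_expR_sum (I : finType) (X : I -> {RV P >-> R}) (a : R)
    (s : seq I) :
  mutually_independent X -> uniq s ->
  \int[P]_w (expR (a * \sum_(i <- s) X i w))%:E =
  \prod_(i <- s) \int[P]_w (expR (a * X i w))%:E.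
Proof.
move=> indX; elim: s => [_|j s IHs jus].
  under eq_integral do rewrite big_nil mulr0 expR0.
  by rewrite integral_cst// mul1e big_nil; exact: probability_setT.
have mexp : measurable_fun setT (fun x : R => expR (a * x)).
  by apply: measurableT_comp => //; exact: measurable_funM.
have /andP[_ us] : (j \notin s) && uniq s by [].
rewrite big_cons -IHs//.
under eq_integral do rewrite big_cons mulrDr expRD.
rewrite (ge0_integral_indep (f := fun p => (expR (a * p.2) * expR (a * p.1))%:E)
  (mutually_indep_sum indX jus)); last 2 first.
- apply/measurable_EFinP; apply: measurable_funM.
    exact: (measurableT_comp mexp measurable_snd).
  exact: (measurableT_comp mexp measurable_fst).
- by move=> p; rewrite lee_fin mulr_ge0 ?expR_ge0.
have mexpX (Y : {RV P >-> R}) :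
    measurable_fun setT (fun w => (expR (a * Y w))%:E).
  apply/measurable_EFinP; exact: (measurableT_comp mexp (measurable_funPT Y)).
transitivity (\int[P]_w ((\int[P]_w' (expR (a * X j w'))%:E) *
                         (expR (a * sum_RV s X w))%:E)).
  apply: eq_integral => w _; rewrite -ge0_integralZr//.
rewrite ge0_integralZl//.
by apply: integral_ge0 => w _; rewrite lee_fin expR_ge0.
Qed.

End independence.

(** * The exponential law: tail, Laplace transform, mean *)

Section exponential.
Local Open Scope ereal_scope.
Context (R : realType) (r : R).
Hypothesis r0 : (0 < r)%R.
Notation mu := lebesgue_measure.

Lemma exponential_prob_lt0 : exponential_prob r `]-oo, 0%R[ = 0.
Proof.
apply: integral0_eq => x; rewrite /= in_itv/= => x0.
by rewrite lt0_exponential_pdf.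
Qed.

Lemma exponential_prob_itvoy (x : R) : (0 <= x)%R ->
  exponential_prob r `]x, +oo[ = (expR (- r * x))%:E.
Proof.
move=> x0.
have mpdf (D : set R) : measurable_fun D (fun x => (exponential_pdf r x)%:E).
  by apply/measurable_EFinP/measurable_funTS; exact: measurable_exponential_pdf.
have pdf0 (y : R) : 0 <= (exponential_pdf r y)%:E.
  by rewrite lee_fin exponential_pdf_ge0// ltW.
(* The negative half-line has mass 0, which leaves the interval from 0 to [x]; the case [x = 0] is a
   single point and is treated apart. The tail then follows because the total mass is 1. *)
have h : exponential_prob r `]-oo, x] = (1 - expR (- r * x))%:E.
  rewrite /exponential_prob (_ : [set` `]-oo, x]] =
      [set` `]-oo, 0%R[] `|` [set` `[0%R, x]] :> set R); last first.
    apply/seteqP; split => y /=; rewrite !in_itv/=.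
      by move=> ->; rewrite andbT; case: ltP; [left|right].
    by case=> [/ltW /le_trans|/andP[]]//; apply.
  rewrite ge0_integral_setU//; [|exact: mpdf|]; last first.
    apply/disj_setPS => y /= []; rewrite !in_itv/= => y0 /andP[].
    by rewrite leNgt y0.
  rewrite [X in X + _]exponential_prob_lt0 add0e.
  move: x0; rewrite le_eqVlt => /predU1P[<-|x0].
    by rewrite mulr0 expR0 subrr set_itv1 integral_set1.
  exact: exponential_prob_itv0c.
have h1 : exponential_prob r `]x, +oo[ + exponential_prob r `]-oo, x] = 1.
  rewrite addeC -(integral_exponential_pdf r0) /exponential_prob.
  rewrite -ge0_integral_setU//; first by rewrite itv_setU_setT.
    exact: mpdf.
  exact: disjoint_rays.
rewrite -[LHS](@addeK _ (1 - expR (- r * x))%:E)// -[in X in X - _]h h1.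
by rewrite -EFinB opprB addrCA subrr addr0.
Qed.

Context (d : measure_display) (T : measurableType d) (P : probability T R).
Variable X : {RV P >-> R}.
Hypothesis lawX : forall A : set R, measurable A ->
  distribution P X A = exponential_prob r A.

Lemma ge0_integral_exponential_law (f : R -> \bar R) :
  measurable_fun setT f -> (forall x, 0 <= f x) ->
  \int[P]_w f (X w) = \int[mu]_x (f x * (exponential_pdf r x)%:E).
Proof.
move=> mf f0.
have pdf0 x : (0 <= exponential_pdf r x)%R.
  by rewrite exponential_pdf_ge0// ltW.
(* The Lebesgue measure lives on [measurableTypeR R], whose display differs
   from that of the codomain of X. *)
pose X' : T -> measurableTypeR R := X.
have mX' : measurable_fun setT X'.
  by move=> mT A mA; exact: (measurable_funPT X mT A mA).
pose nu : {measure set (measurableTypeR R) -> \bar R} := pushforward P X'.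
transitivity (\int[nu mX']_x f x).
  by rewrite ge0_integral_pushforward.
have -> // := @ge0_integral_density _ _ _ mu (nu mX') _
  (measurable_exponential_pdf r) pdf0.
Qed.

(** Exponential tilting: the density of rate [r] times [expR (- a * x)] is [r / (r + a)] times the
    density of rate [r + a], whose integral is 1. *)
Lemma integral_expR_exponential_law (a : R) : (0 <= a)%R ->
  \int[P]_w (expR (- a * X w))%:E = (r / (r + a))%:E.
Proof.
move=> a0; have ra0 : (0 < r + a)%R by rewrite ltr_wpDr.
have mexp : measurable_fun setT (fun x : R => (expR (- a * x))%:E).
  apply/measurable_EFinP; apply: measurableT_comp => //; exact: measurable_funM.
rewrite (ge0_integral_exponential_law mexp); last first.
  by move=> x; rewrite lee_fin expR_ge0.
transitivity (\int[mu]_x ((r / (r + a))%:E * (exponential_pdf (r + a) x)%:E)).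
  apply: eq_integral => x _; rewrite -!EFinM; congr (_%:E).
  have [x0|x0] := ltP x 0%R; first by rewrite !lt0_exponential_pdf// !mulr0.
  rewrite !exponential_pdfE// mulrCA -expRD mulrA divfK ?gt_eqF//.
  by congr (_ * expR _)%R; rewrite -mulrDl opprD addrC.
rewrite ge0_integralZl ?integral_exponential_pdf ?mule1//.
- by apply/measurable_EFinP; exact: measurable_exponential_pdf.
- by move=> x _; rewrite lee_fin exponential_pdf_ge0// ltW.
- by rewrite lee_fin divr_ge0// ltW.
Qed.

Lemma exponential_law_lt0 : P (X @^-1` `]-oo, 0%R[) = 0.
Proof. by rewrite -exponential_prob_lt0 -lawX. Qed.

Lemma ae_ge0_exponential_law : {ae P, forall w, (0 <= X w)%R}.
Proof.
exists (X @^-1` `]-oo, 0%R[); split.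
- exact: measurable_funPTI.
- exact: exponential_law_lt0.
- by move=> w /= /negP; rewrite in_itv/= -ltNge.
Qed.

Lemma exponential_law_gt (x : R) : (0 <= x)%R ->
  P [set w | (x < X w)%R] = (expR (- r * x))%:E.
Proof.
move=> x0; rewrite -exponential_prob_itvoy// -lawX//; congr (P _).
by apply/seteqP; split => w /=; rewrite in_itv/= andbT.
Qed.

Lemma expectation_exponential_law : 'E_P[X] = r^-1%:E.
Proof.
(* The tail formula for the mean asks for nonnegativity everywhere, whereas [X] has it only almost
   surely; hence the detour through the absolute value of [X]. *)
pose Y : {RV P >-> R} := mfun_Sub (mem_set
  (measurableT_comp (@normr_measurable R setT) (measurable_funPT X))).
have XY : {ae P, forall w, X w = Y w}.
  by apply: filterS ae_ge0_exponential_law => w /= X0; rewrite ger0_norm.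
have -> : 'E_P[X] = 'E_P[Y].
  rewrite !unlock; apply: ae_eq_integral => //.
  - exact/measurable_EFinP.
  - exact/measurable_EFinP.
  - by apply: filterS XY => w Xw _; congr EFin.
rewrite ge0_expectation_ccdf; last by move=> w /=.
have mpdf (D : set R) : measurable_fun D (fun x => (exponential_pdf r x)%:E).
  by apply/measurable_EFinP/measurable_funTS; exact: measurable_exponential_pdf.
(* On the nonnegative half-line the tail is [r^-1] times the density. *)
transitivity (\int[mu]_(x in `[0%R, +oo[) (r^-1%:E * (exponential_pdf r x)%:E)).
  apply: eq_integral => x; rewrite inE/= in_itv/= andbT => x0.
  rewrite exponential_pdfE// -EFinM mulrA mulVf ?gt_eqF// mul1r.
  rewrite -exponential_law_gt//.
  change (P (Y @^-1` `]x, +oo[) = P [set w | (x < X w)%R]).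
  apply: (ae_eq_prob (P := P)).
  - exact: (measurable_funPTI Y).
  - rewrite (_ : mkset _ = X @^-1` `]x, +oo[).
      exact: measurable_funPTI.
    by apply/seteqP; split => w /=; rewrite in_itv/= andbT.
  - by apply: (filterS _ XY) => w Xw; rewrite /= in_itv/= andbT -[`|_|%R]Xw.
rewrite ge0_integralZl//.
- rewrite -[RHS]mule1; congr (_ * _); rewrite -(integral_exponential_pdf r0).
  rewrite integral_mkcond; apply: eq_integral => x _; rewrite patchE.
  case: ifPn => //; rewrite notin_setE/= in_itv/= andbT => /negP.
  by rewrite -ltNge => x0; rewrite lt0_exponential_pdf.
- exact: mpdf.
- by move=> x _; rewrite lee_fin exponential_pdf_ge0// ltW.
- by rewrite lee_fin invr_ge0 ltW.
Qed.

End exponential.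

(** * Exponential variable above an independent random threshold *)

Section outage.
Context (d : measure_display) (T : measurableType d) (R : realType)
  (P : probability T R).

Lemma measurable_set_ltr d' (U : measurableType d') (f g : U -> R) :
  measurable_fun setT f -> measurable_fun setT g ->
  measurable [set u | f u < g u].
Proof.
move=> mf mg.
have /(_ measurableT [set true]) := measurable_fun_ltr mf mg.
by rewrite setTI; exact.
Qed.

Lemma indep_exponential_gt (r g : R) (S X : {RV P >-> R}) :
  0 < r -> 0 <= g ->
  (forall A : set R, measurable A -> distribution P X A = exponential_prob r A) ->
  indep_RV S X -> {ae P, forall w, 0 <= S w} ->
  P [set w | g * (1 + S w) < X w] =
  ((expR (- (r * g)))%:E * \int[P]_w (expR (- (r * g) * S w))%:E)%E.
Proof.
move=> r0 g0 lawX SX S0.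
pose D : set (R * R) := [set p | g * (1 + p.1) < p.2].
have mD : measurable D.
  apply: measurable_set_ltr => //.
  by apply: measurable_funM => //; exact: measurable_funD.
pose f (p : R * R) := (\1_D p)%:E : \bar R.
have mf : measurable_fun setT f by exact/measurable_EFinP.
have f0 p : (0 <= f p)%E by rewrite lee_fin.
have mDS : measurable [set w | g * (1 + S w) < X w].
  rewrite (_ : mkset _ = pair_RV S X @^-1` D)//.
  by apply: measurable_funPTI.
transitivity (\int[P]_w f (S w, X w))%E.
  by rewrite -[mkset _]setIT -integral_indic.
have mexp : measurable_fun setT (fun w => (expR (- (r * g) * S w))%:E).
  apply/measurable_EFinP; apply: measurableT_comp => //.
  exact: measurable_funM.
rewrite ge0_integral_indep// -ge0_integralZl//.
- apply: ae_eq_integral => //.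
  (* Measurability of the inner integral in [w] comes from Tonelli on [T * T], with [f'] as
     integrand. *)
  + pose f' (q : T * T) := f (S q.1, X q.2).
    suff mf' : measurable_fun setT f'.
      exact: (measurable_fun_fubini_tonelli_F (m2 := P) f' mf' (fun=> f0 _)).
    apply: measurableT_comp mf _; apply: measurable_fun_pair.
      exact: (measurableT_comp (measurable_funPT S) measurable_fst).
    exact: (measurableT_comp (measurable_funPT X) measurable_snd).
  + exact: measurable_funeM.
  + apply: filterS S0 => w S0 _.
    (* The exponential tail formula holds only at nonnegative thresholds; this is where the sign of
       [S] enters. *)
    have gS0 : 0 <= g * (1 + S w) by rewrite mulr_ge0// addr_ge0.
    rewrite -EFinM -expRD -[X in X + _]mulr1 -mulNr -mulrDr -mulrA.
    rewrite -(exponential_law_gt r0 lawX gS0) -[mkset _]setIT -integral_indic//.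
    exact: measurable_set_ltr.
Qed.

End outage.

(** * Partial fractions: from rational functions to values *)

Lemma prod_inv_eq_sum_div (F : fieldType) (I : finType) (p q a : I -> F) :
  (forall i, p i != 0) -> (forall i, q i != 0) ->
  \prod_i (p i)^-1 = \sum_i a i / q i <->
  \prod_i q i = \prod_i p i * \sum_i a i * \prod_(j | j != i) q j.
Proof.
move=> p0 q0.
have P0 : \prod_i p i != 0 by apply/prodf_neq0 => i _.
have Q0 : \prod_i q i != 0 by apply/prodf_neq0 => i _.
have -> : \sum_i a i * \prod_(j | j != i) q j =
          (\prod_i q i) * \sum_i a i / q i.
  rewrite mulr_sumr; apply: eq_bigr => i _.
  by rewrite [in RHS](bigD1 i)//= mulrC [a i / _]mulrC
     mulrACA mulfV// mul1r.
rewrite prodfV; split=> [<-|].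
  by rewrite mulrCA mulfV ?mulr1.
rewrite mulrCA -[X in X = _ -> _]mulr1 => /(mulfI Q0) PS.
by apply: (mulfI P0); rewrite mulfV.
Qed.

(** Rational functions cannot be evaluated directly, so the denominators are cleared in R(x), the
    resulting polynomial identity is evaluated at [x], and the denominators are restored in [R]. *)
Lemma partial_fraction_eval (R : realType) (N : nat) (m alpha : 'I_N -> R)
    (x : R) :
  (forall t, m t != 0) -> (forall t, x != (m t)^-1) ->
  partial_fraction_decomposition m alpha ->
  \prod_(t < N) (1 - x * m t)^-1 = \sum_(t < N) alpha t / (x - 1 / m t).
Proof.
move=> m0 xm; pose p t : {poly R} := 1 - 'X * (m t)%:P.
pose q t : {poly R} := 'X - (1 / m t)%:P.
have p0 t : p t != 0.
  apply/eqP => /(congr1 (fun f => f.[0])) /eqP.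
  by rewrite !hornerE/= ?(mul0r, mulr0) subr0 oner_eq0.
have q0 t : q t != 0 by rewrite polyXsubC_eq0.
move=> /prod_inv_eq_sum_div pf; apply/prod_inv_eq_sum_div.
- move=> t; rewrite subr_eq0; apply: contraNneq (xm t) => xm1.
  by rewrite -[x](mulfK (m0 t)) -xm1 mul1r.
- by move=> t; rewrite subr_eq0 div1r.
(* The cleared identity has only polynomial terms and descends from R(x) because [tofrac] is
   injective. *)
have {}pf : \prod_t q t =
    \prod_t p t * \sum_t (alpha t)%:P * \prod_(s | s != t) q s.
  apply/eqP; rewrite -tofrac_eq; apply/eqP.
  rewrite rmorphM rmorph_sum !rmorph_prod/= pf; last 2 first.
  - by move=> t; rewrite tofrac_eq0; exact: p0.
  - by move=> t; rewrite tofrac_eq0; exact: q0.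
  congr (_ * _); apply: eq_bigr => t _.
  by rewrite rmorphM rmorph_prod.
move: pf => /(congr1 (fun f => f.[x])).
rewrite hornerM horner_sum !horner_prod.
have qE t : (q t).[x] = x - 1 / m t by rewrite /q !hornerE.
have pE t : (p t).[x] = 1 - x * m t by rewrite /p !hornerE mulrC.
under eq_bigr do rewrite qE.
move=> ->; congr (_ * _); apply: eq_bigr => t _ //.
rewrite hornerM hornerC horner_prod; congr (_ * _).
by apply: eq_bigr => s _; rewrite qE.
Qed.

(** * The outage probability *)

Lemma exponential_of_meanP (d : measure_display) (T : measurableType d)
    (R : realType) (P : probability T R) (X : {RV P >-> R}) (m : R) :
  exponential_of_mean X m -> 0 < m^-1 /\ forall A : set R, measurable A ->
    distribution P X A = exponential_prob m^-1 A.
Proof.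
(* The definition only provides some rate [r]; computing the mean forces [m = r^-1]. *)
move=> [[r r0 lawX]]; rewrite (expectation_exponential_law r0 lawX) => -[<-].
by rewrite invrK.
Qed.

(* Multiplying by s ^+ 2 keeps the equivalence valid at s = 0, where
   x / 0 = 0. *)
Lemma ler_div_sqr (R : realType) (x s g : R) : 0 <= g ->
  (x / s <= g) = ~~ (g * s ^+ 2 < x * s).
Proof.
move=> g0; rewrite -leNgt; have [->|s0] := eqVneq s 0.
  by rewrite invr0 !mulr0 g0 expr0n mulr0 lexx.
have s2 : 0 < s ^+ 2 by rewrite exprn_even_gt0.
have -> : x * s = x / s * s ^+ 2 by rewrite expr2 mulrA divfK.
by rewrite ler_pM2r.
Qed.

Theorem theorem1 (d : measure_display) (T : measurableType d) (R : realType)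
    (P : probability T R) (N : nat) (gth : R)
    (mean_u : R) (mean : 'I_N -> R)
    (gamma_u : {RV P >-> R}) (gamma : 'I_N -> {RV P >-> R})
    (alpha : 'I_N -> R) :
  (1 <= N)%N ->
  0 < gth ->
  0 < mean_u ->
  (forall t, 0 < mean t) ->
  mutually_independent (all_links gamma_u gamma) ->
  exponential_of_mean gamma_u mean_u ->
  (forall t, exponential_of_mean (gamma t) (mean t)) ->
  partial_fraction_decomposition mean alpha ->
  outage_probability P (SINR gamma_u (fun t => gamma t)) gth =
  (1 + expR (- (gth / mean_u)) *
       \sum_(t < N) alpha t / (gth / mean_u + 1 / mean t))%:E.
Proof.
move=> _ gth0 mu0 m0 indX expu expX pf.
have [r0 lawu] := exponential_of_meanP expu.
(* The interfering links are listed inside the joint index type, so that with [None] as head the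
   serving link is independent of their sum. *)
pose s : seq (option 'I_N) := map Some (enum 'I_N).
have us : uniq (None :: s).
  rewrite /= map_inj_uniq ?enum_uniq ?andbT; last exact: Some_inj.
  by apply/mapP => -[].
pose S := sum_RV s (all_links gamma_u gamma).
have SE w : S w = \sum_(t < N) gamma t w.
  by rewrite /= big_map big_enum.
have X0 : {ae P, forall w, forall t, 0 <= gamma t w}.
  apply: filter_forall => t.
  by have [rt0 lawt] := exponential_of_meanP (expX t);
    exact: (ae_ge0_exponential_law lawt).
have S0 : {ae P, forall w, 0 <= S w}.
  by apply: (filterS _ X0) => w w0; rewrite SE; apply: sumr_ge0.
set c := gth / mean_u.
have c0 : 0 < c by rewrite divr_gt0.
have tailE : P [set w | gth * (1 + S w) < gamma_u w] =
    (expR (- c) * \prod_(t < N) (1 + c * mean t)^-1)%:E.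
  rewrite (indep_exponential_gt r0 (ltW gth0) lawu _ S0); last first.
    exact: (mutually_indep_sum indX us).
  rewrite [_^-1 * _]mulrC -/c EFinM; congr (_ * _)%E.
  under eq_integral do rewrite /=.
  rewrite integral_expR_sum//; last by case/andP: us.
  rewrite big_map big_enum/= -prodEFin; apply: eq_bigr => t _.
  have [rt0 lawt] := exponential_of_meanP (expX t).
  rewrite (integral_expR_exponential_law rt0 lawt (ltW c0)); congr EFin.
  have mt0 : mean t != 0 by rewrite gt_eqF.
  (* With rate [(mean t)^-1], the Laplace transform at [c] is [(mean t)^-1 / ((mean t)^-1 + c)],
     which is the inverse of this quantity. *)
  have -> : 1 + c * mean t = ((mean t)^-1 + c) * mean t by rewrite mulrDl mulVf.
  by rewrite invfM mulrC.
have mu : measurable_fun setT gamma_u by exact: measurable_funPT.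
have m1S : measurable_fun setT (fun w => 1 + S w).
  exact: measurable_funD.
have mgt : measurable [set w | gth * (1 + S w) < gamma_u w].
  by apply: measurable_set_ltr => //; exact: measurable_funM.
(* The denominator may vanish or be negative on a null set, so the event is first rewritten without
   division. *)
have mle : measurable [set w | SINR gamma_u (fun t => gamma t) w <= gth].
  rewrite (_ : mkset _ = ~` [set w | gth * (1 + S w) ^+ 2 <
                                    gamma_u w * (1 + S w)]).
    apply: measurableC; apply: measurable_set_ltr.
      by apply: measurable_funM => //; exact: measurable_funX.
    exact: measurable_funM.
  apply/seteqP; split=> w /=; rewrite /SINR -SE ler_div_sqr ?ltW// => /negP //.
(* Where [S] is nonnegative, [1 + S w] is positive and the quotient can be cleared; hence the two
   events agree almost surely. *)
transitivity (P (~` [set w | gth * (1 + S w) < gamma_u w])).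
  apply: ae_eq_prob => //; first exact: measurableC.
  apply: (filterS _ S0) => w Sw0; rewrite /= /SINR -SE ler_pdivrMr.
    by rewrite leNgt; split => /negP.
  by rewrite ltr_pwDl.
rewrite probability_setC// tailE -EFinB; congr EFin.
rewrite -mulrN; congr (_ + _ * _).
(* At [- c] each denominator is the opposite of [c + 1 / mean t], and this sign cancels the minus of
   the complement. No pole is met: [- c] is negative and every [(mean t)^-1] is positive. *)
have := @partial_fraction_eval _ _ _ _ (- c) (fun t => lt0r_neq0 (m0 t)) _ pf.
under eq_bigr do rewrite mulNr opprK.
move=> ->.
  rewrite -sumrN; apply: eq_bigr => t _.
  by rewrite -mulrN -invrN opprB opprK addrC.
by move=> t; rewrite lt_eqF// (lt_trans _ (_ : 0 < _)) ?oppr_lt0 ?invr_gt0.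
Qed.
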